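(* Let $X$ be a connected finite polyhedron, $n\ge1$, and let $f\colon X\to D_n(X)$ be an $n$-valued map with a fixed basic lifting $\bar f^*=(\bar f^*_1,\dots,\bar f^*_n)$ and associated homomorphism $\psi_f(\gamma)=(\phi_1(\gamma),\dots,\phi_n(\gamma);\sigma_\gamma)$. Let $i_1,\dots,i_r\in\{1,\dots,n\}$ be a set of representatives (exactly one for each class) of the equivalence relation on $\{1,\dots,n\}$ given by $i\sim j$ if and only if there is $\gamma\in\pi_1(X)$ with $\sigma_\gamma(j)=i$. Then $$R(f)=R(\phi_{i_1})+R(\phi_{i_2})+\cdots+R(\phi_{i_r}),$$ where, for $i\in\{1,\dots,n\}$, $R(\phi_i)$ is the number (possibly $\infty$) of equivalence classes of the relation $\sim_i$ on $\pi_1(X)$ defined by: $\alpha\sim_i\beta$ if and only if there exists $\gamma\in S_i=\{\gamma\in\pi_1(X)\mid\sigma_\gamma(i)=i\}$ such that $\alpha=\gamma\,\beta\,\phi_i(\gamma^{-1})$.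
   Context: Let $p\colon\tilde X\to X$ be the universal covering space; $\pi_1(X)$ is identified with the group of covering transformations of $p$. $F_n(X)=\{(x_1,\dots,x_n)\in X^n\mid x_i\ne x_j \text{ for } i\ne j\}$ has the subspace topology, and $D_n(X)$, the set of $n$-element subsets of $X$, has the quotient topology as the orbit space of $F_n(X)$ under the symmetric group $\Sigma_n$. An $n$-valued map is a continuous map $f\colon X\to D_n(X)$. The orbit configuration space is $F_n(\tilde X,\pi)=\{(\tilde x_1,\dots,\tilde x_n)\in\tilde X^n\mid \tilde x_i\ne\alpha\tilde x_j \text{ for all } i\neq j,\ \alpha\in\pi_1(X)\}$, with projection $p^n\colon F_n(\tilde X,\pi)\to D_n(X)$, $p^n(\tilde x_1,\dots,\tilde x_n)=\{p(\tilde x_1),\dots,p(\tilde x_n)\}$. A lifting of $f$ is a continuous map $\bar f=(\bar f_1,\dots,\bar f_n)\colon\tilde X\to F_n(\tilde X,\pi)$ with $p^n\circ\bar f=f\circ p$; the coordinate maps of all liftings of $f$ are the lift-factors of $f$. Two lift-factors are equivalent, $\bar f_i\sim_{lf}\bar f'_j$, if $\bar f_i=\gamma\bar f'_j\gamma^{-1}$ for some $\gamma\in\pi_1(X)$; the Reidemeister number $R(f)$ is the number (possibly $\infty$) of equivalence classes of lift-factors. The group $\pi_1(X)^n\rtimes\Sigma_n$, with product $(\alpha_1,\dots,\alpha_n;\sigma)(\beta_1,\dots,\beta_n;\rho)=(\alpha_1\beta_{\sigma^{-1}(1)},\dots,\alpha_n\beta_{\sigma^{-1}(n)};\sigma\circ\rho)$,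 acts on $F_n(\tilde X,\pi)$ by $(\alpha_1,\dots,\alpha_n;\sigma)\cdot(\tilde x_1,\dots,\tilde x_n)=(\alpha_1\tilde x_{\sigma^{-1}(1)},\dots,\alpha_n\tilde x_{\sigma^{-1}(n)})$. Choose $\tilde x^*\in\tilde X$ and $\tilde x^{(0)}\in F_n(\tilde X,\pi)$ with $p^n(\tilde x^{(0)})=f(p(\tilde x^* ))$; the basic lifting $\bar f^*$ is the unique lifting of $f$ with $\bar f^*(\tilde x^* )=\tilde x^{(0)}$. Every lifting of $f$ is uniquely of the form $\Gamma\bar f^*$ with $\Gamma\in\pi_1(X)^n\rtimes\Sigma_n$. The homomorphism $\psi_f\colon\pi_1(X)\to\pi_1(X)^n\rtimes\Sigma_n$ is defined by $\psi_f(\gamma)\circ\bar f^*=\bar f^*\circ\gamma$ for all $\gamma\in\pi_1(X)$, and one writes $\psi_f(\gamma)=(\phi_1(\gamma),\dots,\phi_n(\gamma);\sigma_\gamma)$. *)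

(* Defs.v *)
From HB Require Import structures.
From mathcomp Require Import all_boot all_order all_algebra all_fingroup.
From mathcomp Require Import finmap.
From mathcomp Require Import all_classical all_reals all_analysis.

Set Implicit Arguments.
Unset Strict Implicit.
Unset Printing Implicit Defensive.

Import Order.TTheory GRing.Theory Num.Theory.
Import numFieldNormedType.Exports.

Local Open Scope classical_set_scope.
Local Open Scope ring_scope.

Section Polyhedra.
Context (R : realType).

Section Complexes.
Context (m : nat).
Implicit Types (s t : {fset 'rV[R]_m}) (K : {fset {fset 'rV[R]_m}}).

Definition affinely_independent s :=
  forall w : 'rV[R]_m -> R,
    \sum_(v <- s) w v = 0 -> \sum_(v <- s) w v *: v = 0 ->
    forall v, v \in s -> w v = 0.

(* The convex hull of the empty set of vertices is empty. *)
Definition convex_hull s : set 'rV[R]_m :=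
  [set x | exists w : 'rV[R]_m -> R,
     [/\ forall v, v \in s -> 0 <= w v,
         \sum_(v <- s) w v = 1 & x = \sum_(v <- s) w v *: v]].

(* Simplices are represented by their sets of vertices. *)
Definition simplicial_complex K :=
  [/\ forall s, s \in K -> s != fset0 /\ affinely_independent s,
      forall s t, s \in K -> (t `<=` s)%fset -> t != fset0 -> t \in K
    & forall s t, s \in K -> t \in K ->
        convex_hull s `&` convex_hull t `<=` convex_hull (s `&` t)%fset].

Definition underlying_space K : set 'rV[R]_m :=
  \bigcup_(s in [set` K]) convex_hull s.

End Complexes.

Definition homeomorphic (T U : topologicalType) :=
  exists (g : T -> U) (h : U -> T),
    [/\ continuous g, continuous h, cancel g h & cancel h g].

Definition finite_polyhedron (X : topologicalType) :=
  exists (m : nat) (K : {fset {fset 'rV[R]_m}}),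
    simplicial_complex K /\ homeomorphic X (set_type (underlying_space K)).

Section Coverings.
Context (T : topologicalType).

Definition is_path (x y : T) (g : R -> T) :=
  [/\ {within `[0, 1], continuous g}, g 0 = x & g 1 = y].

Definition path_connected := forall x y : T, exists g, is_path x y g.

Definition null_homotopic (x : T) (g : R -> T) :=
  exists H : R * R -> T,
    [/\ {within `[0, 1] `*` `[0, 1], continuous H},
        forall s, 0 <= s <= 1 -> H (s, 0) = g s /\ H (s, 1) = x
      & forall t, 0 <= t <= 1 -> H (0, t) = x /\ H (1, t) = x].

Definition simply_connected :=
  path_connected /\ forall x g, is_path x x g -> null_homotopic x g.

End Coverings.
End Polyhedra.

Definition homeo_on (E X : topologicalType) (p : E -> X)
    (V : set E) (U : set X) :=
  [/\ {within V, continuous p}, set_bij V U p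
    & exists s : X -> E,
        {within U, continuous s} /\ {in V, cancel p s}].

Definition evenly_covered (E X : topologicalType) (p : E -> X) (U : set X) :=
  exists F : set (set E),
    [/\ trivIset F id, p @^-1` U = \bigcup_(V in F) V
      & forall V, F V -> open V /\ homeo_on p V U].

Definition covering_map (E X : topologicalType) (p : E -> X) :=
  [/\ continuous p, set_surj setT setT p
    & forall x, exists U, [/\ open U, U x & evenly_covered p U]].

Definition universal_covering (R : realType) (E X : topologicalType)
    (p : E -> X) :=
  covering_map p /\ simply_connected R E.

(* The fundamental group enters as the group of covering transformations. *)
Section Deck.
Context (E X : topologicalType) (p : E -> X).

Record deck := Deck {
  deck_fun :> E -> E;
  deck_inv : E -> E;
  deck_continuous : continuous deck_fun;
  deck_inv_continuous : continuous deck_inv;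
  deck_funK : cancel deck_fun deck_inv;
  deck_invK : cancel deck_inv deck_fun;
  deck_over : p \o deck_fun = p }.

Lemma deck_ext (a b : deck) : deck_fun a = deck_fun b -> a = b.
Proof.
case: a b => [f f' c c' K K' o] [g g' d d' L L' q] /= fg.
subst g; have fg' : f' = g'.
  by apply/funext => x; rewrite -{1}[x]L' K.
subst g'; congr Deck; exact: Prop_irrelevance.
Qed.

HB.instance Definition _ := gen_eqMixin deck.
HB.instance Definition _ := gen_choiceMixin deck.

Definition deck1 : deck :=
  @Deck id id (fun=> cvg_id) (fun=> cvg_id) (fun=> erefl) (fun=> erefl) erefl.

Lemma deckV_over (a : deck) : p \o deck_inv a = p.
Proof.
apply/funext => x /=.
by rewrite -[in LHS](deck_over a) /= deck_invK.
Qed.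

Definition deckV (a : deck) : deck :=
  Deck (@deck_inv_continuous a) (@deck_continuous a)
    (@deck_invK a) (@deck_funK a) (deckV_over a).

Lemma deckM_continuous (g h : E -> E) :
  continuous g -> continuous h -> continuous (g \o h).
Proof. by move=> cg ch x; apply: continuous_comp; [exact: ch|exact: cg]. Qed.

Lemma deckM_over (a b : deck) : p \o (a \o b) = p.
Proof. by rewrite compA !deck_over. Qed.

Definition deckM (a b : deck) : deck :=
  Deck (deckM_continuous (@deck_continuous a) (@deck_continuous b))
    (deckM_continuous (@deck_inv_continuous b) (@deck_inv_continuous a))
    (can_comp (@deck_funK a) (@deck_funK b))
    (can_comp (@deck_invK b) (@deck_invK a)) (deckM_over a b).

Lemma deckMA : associative deckM. Proof. by move=> *; exact: deck_ext. Qed.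
Lemma deck1M : left_id deck1 deckM. Proof. by move=> *; exact: deck_ext. Qed.
Lemma deckM1 : right_id deck1 deckM. Proof. by move=> *; exact: deck_ext. Qed.
Lemma deckVM : left_inverse deck1 deckV deckM.
Proof. by move=> a; apply/deck_ext/funext => x /=; exact: deck_funK. Qed.
Lemma deckMV : right_inverse deck1 deckV deckM.
Proof. by move=> a; apply/deck_ext/funext => x /=; exact: deck_invK. Qed.

HB.instance Definition _ :=
  isGroup.Build deck deckMA deck1M deckM1 deckVM deckMV.

End Deck.

(* The ordered configuration space F_n(X), with the subspace topology of the
   product X^n. *)
Definition Fconf (X : topologicalType) (n : nat) : set {ptws 'I_n -> X} :=
  [set x | injective x].
Arguments Fconf : clear implicits.

(* D_n(X), the set of n-element subsets of X. *)
Record Dconf (X : topologicalType) (n : nat) := MkDconf {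
  points :> set X;
  card_points : (points #= `I_n)%card }.

Section DconfTopology.
Context (X : topologicalType) (n : nat).

Lemma card_range_Fconf (x : Fconf X n) : (range (set_val x) #= `I_n)%card.
Proof.
have inj_x : injective (set_val x) by exact: (set_valP x).
apply: card_eq_trans; first by apply: inj_card_eq => i j _ _; exact: inj_x.
by rewrite card_eq_sym card_II.
Qed.

Definition unordered (x : Fconf X n) : Dconf X n :=
  MkDconf (card_range_Fconf x).

HB.instance Definition _ := gen_eqMixin (Dconf X n).
HB.instance Definition _ := gen_choiceMixin (Dconf X n).

(* The quotient topology of [unordered], whose fibres are the orbits of the
   symmetric group on F_n(X). *)
Definition Dconf_open (U : set (Dconf X n)) := open (unordered @^-1` U).

Lemma Dconf_openT : Dconf_open setT.
Proof. by rewrite /Dconf_open preimage_setT; exact: openT. Qed.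

Lemma Dconf_openI : setI_closed Dconf_open.
Proof. by move=> U V oU oV; exact: openI. Qed.

Lemma Dconf_open_bigU (I : Type) (U : I -> set (Dconf X n)) :
  (forall i, Dconf_open (U i)) -> Dconf_open (\bigcup_i U i).
Proof. by move=> oU; apply: bigcup_open => i _; exact: oU. Qed.

HB.instance Definition _ := isOpenTopological.Build (Dconf X n)
  Dconf_openT Dconf_openI Dconf_open_bigU.

End DconfTopology.

Section NValued.
Context (E X : topologicalType) (p : E -> X) (n : nat).

(* The orbit configuration space F_n(E, pi). *)
Definition orbit_conf : set {ptws 'I_n -> E} :=
  [set x | forall (i j : 'I_n) (a : deck p), i != j -> x i <> a (x j)].

(* p^n is stated with values in subsets of X: that the image has exactly n
   elements uses that p is a regular covering. *)
Definition proj_conf (x : orbit_conf) : set X :=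
  range (fun i => p (set_val x i)).

(* The element (translation_0, ..., translation_(n-1); permutation) of the
   semidirect product of deck^n with the symmetric group. *)
Record semidirect := Semidirect {
  translation : 'I_n -> deck p;
  permutation : 'S_n }.

Definition act_fun (G : semidirect) (x : {ptws 'I_n -> E}) :
    {ptws 'I_n -> E} :=
  fun i => translation G i (x ((permutation G)^-1%g i)).

Lemma act_subproof (G : semidirect) (x : orbit_conf) :
  act_fun G (set_val x) \in orbit_conf.
Proof.
apply/mem_set => i j a ij; rewrite /act_fun => eq_ij.
have /(_ (((translation G i)^-1 * a * translation G j)%g : deck p)) :=
  @set_valP _ _ x ((permutation G)^-1%g i) ((permutation G)^-1%g j).
rewrite (inj_eq perm_inj) => /(_ ij); apply.
apply: (can_inj (deck_funK (translation G i))); rewrite eq_ij /=.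
by rewrite deck_invK.
Qed.

Definition act (G : semidirect) (x : orbit_conf) : orbit_conf :=
  SigSub (act_subproof G x).

Context (f : X -> Dconf X n).

Definition lifting (fb : E -> orbit_conf) :=
  continuous fb /\ forall x, proj_conf (fb x) = f (p x).

Definition basic_lifting (xs : E) (x0 : orbit_conf) (fb : E -> orbit_conf) :=
  [/\ proj_conf x0 = f (p xs), lifting fb & fb xs = x0].

Definition coord (fb : E -> orbit_conf) (i : 'I_n) : E -> E :=
  fun x => set_val (fb x) i.

Definition lift_factor : set (E -> E) :=
  [set g | exists (fb : E -> orbit_conf) (i : 'I_n),
     lifting fb /\ g = coord fb i].

Definition lift_factor_equiv (g h : E -> E) :=
  exists a : deck p, g = a \o h \o (a^-1)%g.

(* The defining equation of the homomorphism psi_f associated with the basic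
   lifting fb. *)
Definition associated_hom (fb : E -> orbit_conf) (psi : deck p -> semidirect) :=
  forall (a : deck p) (x : E), act (psi a) (fb x) = fb (a x).

Section Components.
Context (psi : deck p -> semidirect).

Definition phi (i : 'I_n) (a : deck p) : deck p := translation (psi a) i.
Definition sigma (a : deck p) : 'S_n := permutation (psi a).

Definition sigma_equiv (i j : 'I_n) := exists a : deck p, sigma a j = i.

Definition stabilizer (i : 'I_n) : set (deck p) := [set a | sigma a i = i].

Definition phi_equiv (i : 'I_n) (a b : deck p) :=
  exists2 c : deck p, stabilizer i c & a = (c * b * phi i (c^-1))%g.

End Components.
End NValued.

Arguments orbit_conf {E X} p n.
Arguments semidirect {E X} p n.
Arguments lift_factor {E X} p {n} f.
Arguments lift_factor_equiv {E X} p.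

(* The number of classes, [+oo] when there are infinitely many, of an
   equivalence relation [e] on [A]. *)
Definition number_of_classes (R : realType) (T : Type) (A : set T)
    (e : T -> T -> Prop) : \bar R :=
  counting [set [set y | A y /\ e x y] | x in A].

Definition reidemeister (R : realType) (E X : topologicalType) (p : E -> X)
    (n : nat) (f : X -> Dconf X n) : \bar R :=
  number_of_classes R (lift_factor p f) (lift_factor_equiv p).

Definition reidemeister_phi (R : realType) (E X : topologicalType)
    (p : E -> X) (n : nat) (psi : deck p -> semidirect p n) (i : 'I_n) :
    \bar R :=
  number_of_classes R [set: deck p] (phi_equiv psi i).

(* Main.v *)
Require Import Defs.
From mathcomp Require Import all_boot all_order all_algebra all_fingroup.
From mathcomp Require Import finmap.
From mathcomp Require Import all_classical all_reals all_analysis.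
From mathcomp Require Import lra.

Set Implicit Arguments.
Unset Strict Implicit.
Unset Printing Implicit Defensive.

Import Order.TTheory GRing.Theory Num.Theory.
Import numFieldNormedType.Exports.

Local Open Scope classical_set_scope.
Local Open Scope ring_scope.

(** Why the formula holds.  Write [h_i] for the [i]-th coordinate of the basic
lifting and call [a \o h_i], with [a] a covering transformation, a translate.

Lift-factors are exactly the translates, and each one is [a \o h_i] for a
single pair [(a, i)].  Indeed let [g] be a lift-factor.  Over each point [x],
[p (g x)] is one of the [n] distinct points [p (h_j x)], so, the covering being
regular, [g x = a (h_j x)] for some [a] and [j].  As [X] is Hausdorff, [j] is
locally constant; as [p] is a covering, so is [a]; and [E] is connected.  This
is [lift_factor_coord], with converse [deck_coord_lift_factor] and uniqueness
[deck_coord_inj].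

Next, the defining equation of [psi] gives
[c \o (b \o h_j) \o c^-1 = (c * b * phi_j (c^-1)) \o h_(sigma_c j)], so
[a \o h_i] and [b \o h_j] are equivalent if and only if, for some [c],
[i = sigma_c j] and [a = c * b * phi_j (c^-1)] ([lift_factor_equivP]).
Consequently every class meets the translates of [h_i] for exactly one
representative index [i], and among the translates of this [h_i] the relation
is the twisted conjugacy [phi_equiv psi i].  The classes of lift-factors are
thus the disjoint union, over the representatives, of the classes of the
relations [phi_equiv psi i]; [number_of_classes_sum] counts them.

The topological input is that the covering transformations act freely and
transitively on the fibres of the universal covering ([deck_free],
[deck_transitive]).  Transitivity is proved by moving along paths of the fibre
product of [E] with itself over [X]: from [(e, e')] such a path leads to [(y, y')]
with [y] arbitrary, and [y'] depends on [y] only, because a null homotopy of a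
loop of [E] can be projected to [X] and lifted again from another point of the
fibre.  The map [y |-> y'] is the required transformation; its continuity uses
that [X] is locally path-connected.  A finite polyhedron is so because near a
point it is star-shaped, being a finite union of compact convex sets. *)

(** * Continuity and connectedness *)

Lemma continuous_pair (S T U : topologicalType) (f : S -> T) (g : S -> U) :
  continuous f -> continuous g -> continuous (fun x => (f x, g x)).
Proof. by move=> cf cg x; apply: cvg_pair; [exact: cf|exact: cg]. Qed.

Lemma continuous_within_eq (T U : topologicalType) (A : set T) (f g : T -> U) :
  (forall x, A x -> f x = g x) -> {within A, continuous f} ->
  {within A, continuous g}.
Proof. by move=> fg; apply: subspace_eq_continuous => x /set_mem; exact: fg. Qed.

Lemma continuous_within_comp (S T U : topologicalType) (A : set T)
    (g : T -> U) (r : S -> T) :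
  {within A, continuous g} -> continuous r -> (forall x, A (r x)) ->
  continuous (g \o r).
Proof.
move=> /subspace_continuousP cg cr Ar x W /= /(cg _ (Ar x)) gW.
have := cr x _ gW; rewrite !nbhs_simpl/=; apply: filterS => y /= Wy.
by apply: Wy; exact: Ar.
Qed.

(** Clopen induction: a property holding at one point of a connected set, and
locally constant along it, holds throughout. *)
Lemma connected_locally_constant (T : topologicalType) (K P : set T) (k0 : T) :
  connected K ->
  (forall k, K k -> P k -> \forall k' \near within K (nbhs k), P k') ->
  (forall k, K k -> ~ P k -> \forall k' \near within K (nbhs k), ~ P k') ->
  K k0 -> P k0 -> K `<=` P.
Proof.
move=> /clopen_connectedP cK oP cP Kk0 Pk0.
suff <- : K `&` P = K by move=> k [].
apply: cK; [split| by move=> k [] | by exists k0].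
  suff oKP : forall k : T, (K `&` P) k -> @nbhs_subspace T K k (K `&` P).
    by rewrite openE => k /oKP.
  move=> k [Kk Pk]; rewrite -(nbhs_subspace_in Kk).
  exact: (filterI (withinT K (nbhs_filter k)) (oP _ Kk Pk)).
rewrite -[_ `&` _]setCK; apply: open_closedC.
suff oKP : forall k : T, ~ (K `&` P) k -> @nbhs_subspace T K k (~` (K `&` P)).
  by rewrite openE => k /oKP.
move=> k nKPk; have [Kk|nKk] := pselect (K k); last first.
  by rewrite -(nbhs_subspace_out nKk) => _ ->.
rewrite -(nbhs_subspace_in Kk).
have /(cP _ Kk) : ~ P k by move=> Pk; apply: nKPk.
by apply: filterS => k' nPk' [].
Qed.

(** * Uniqueness and gluing of lifts *)

Section Covering.
Context (E X : topologicalType) (p : E -> X).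

(** [V] is a sheet over [U] and [s] the inverse of [p] on it. *)
Definition local_section (U : set X) (V : set E) (s : X -> E) :=
  [/\ open V, forall e, V e -> U (p e) /\ s (p e) = e,
      forall x, U x -> V (s x) /\ p (s x) = x
    & forall x, U x -> {for x, continuous s}].

Hypothesis cov : covering_map p.

Lemma covering_local_section (x : X) :
  exists U : set X, [/\ open U, U x &
    forall e, U (p e) -> exists V s, local_section U V s /\ V e].
Proof.
have [_ _ /(_ x)[U [oU Ux [F [_ preU FV]]]]] := cov.
exists U; split=> // e Upe.
have [V FVV Ve] : (\bigcup_(V in F) V) e by rewrite -preU.
have [oV [_ [pVU _ surjp] [s [cs Vs]]]] := FV _ FVV.
exists V, s; split=> //; split=> //.
- by move=> e' Ve'; split; [exact: pVU | apply: Vs; rewrite inE].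
- move=> y /surjp[v Vv <-]; rewrite Vs ?inE//.
- by move=> y Uy; move: cs; rewrite continuous_open_subspace//; apply; rewrite inE.
Qed.

(** Two sheets over the same evenly covered set are equal or disjoint, and a
sheet contains only one point of each fibre. *)
Lemma covering_fibre_separated (e e' : E) : p e = p e' -> e <> e' ->
  exists V V' : set E, [/\ open V, open V', V e, V' e' & V `&` V' = set0].
Proof.
have [_ _ /(_ (p e))[U [oU Ue [F [tF preU FV]]]]] := cov.
move=> ee' nee'.
have [V FVV Ve] : (\bigcup_(V in F) V) e by rewrite -preU.
have [V' FVV' Ve'] : (\bigcup_(V in F) V) e' by rewrite -preU /preimage/= -ee'.
have [oV [_ [_ injp _] _]] := FV _ FVV; have [oV' _] := FV _ FVV'.
exists V, V'; split=> //; apply/eqP/negPn/negP => /set0P VV'.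
have VE := tF _ _ FVV FVV' VV'; subst V'.
by apply: nee'; apply: injp; rewrite ?inE.
Qed.

(** Where two lifts agree they agree nearby, since [p] is injective on a sheet;
where they differ they differ nearby, since distinct points of a fibre lie in
disjoint sheets. *)
Lemma lift_unique (Y : topologicalType) (K : set Y) (u v : Y -> E) (k0 : Y) :
  connected K -> {within K, continuous u} -> {within K, continuous v} ->
  (forall k, K k -> p (u k) = p (v k)) -> K k0 -> u k0 = v k0 ->
  forall k, K k -> u k = v k.
Proof.
move=> cK /subspace_continuousP cu /subspace_continuousP cv puv Kk0 uv0.
apply: (connected_locally_constant cK _ _ Kk0 uv0) => k Kk uvk.
  have [U [oU Ux /(_ (u k) Ux)[V [s [[oV Vs _ _] Vuk]]]]] :=
    covering_local_section (p (u k)).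
  have nu := cu _ Kk _ (open_nbhs_nbhs (conj oV Vuk)).
  rewrite uvk in Vuk; have nv := cv _ Kk _ (open_nbhs_nbhs (conj oV Vuk)).
  have nK : within K (nbhs k) K by exact: withinT.
  near=> k'.
  have Vu : V (u k') by near: k'.
  have Vv : V (v k') by near: k'.
  have Kk' : K k' by near: k'.
  by rewrite -[LHS](Vs _ Vu).2 -[RHS](Vs _ Vv).2 puv.
have [V [V' [oV oV' Vu Vv VV']]] := covering_fibre_separated (puv _ Kk) uvk.
have nu := cu _ Kk _ (open_nbhs_nbhs (conj oV Vu)).
have nv := cv _ Kk _ (open_nbhs_nbhs (conj oV' Vv)).
near=> k' => uvk'.
have : (V `&` V') (u k') by split; [|rewrite uvk']; near: k'.
by rewrite VV'.
Unshelve. all: by end_near. Qed.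

(** The lift is required through every point over every base point of [K], not
just over a chosen one; this makes the notion pass to subsets and glue. *)
Definition lifts_on (Y : topologicalType) (H : Y -> X) (K : set Y) :=
  forall z e, K z -> p e = H z -> exists L : Y -> E,
    [/\ {within K, continuous L}, L z = e & forall y, K y -> p (L y) = H y].

Lemma lifts_onS (Y : topologicalType) (H : Y -> X) (K K' : set Y) :
  K `<=` K' -> lifts_on H K' -> lifts_on H K.
Proof.
move=> KK' lK' z e Kz /(lK' z e (KK' _ Kz))[L [cL Lz pL]].
exists L; split=> //; first exact: continuous_subspaceW cL.
by move=> y /KK'; exact: pL.
Qed.

Lemma lifts_on_small (Y : topologicalType) (H : Y -> X) (y : Y) :
  continuous H -> exists2 N, nbhs y N & lifts_on H N.
Proof.
move=> cH; have [U [oU Ux secU]] := covering_local_section (H y).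
exists (H @^-1` U); first by apply: cH; exact: open_nbhs_nbhs.
move=> z e Uz pe.
have [|V [s [[oV Vs Us cs] Ve]]] := secU e; first by rewrite pe.
exists (s \o H); split.
- apply: continuous_in_subspaceT => y' /set_mem Uy'.
  by apply: continuous_comp; [exact: cH | exact: cs].
- by rewrite /= -pe (Vs _ Ve).2.
- by move=> y' /Us[].
Qed.

(** Lift over [K1], then over [K2] from the value already found at [w]; as
[K1 `&` K2] is connected the two lifts agree there and can be pasted. *)
Lemma lifts_onU (Y : topologicalType) (H : Y -> X) (K1 K2 : set Y) (w : Y) :
  closed K1 -> closed K2 -> connected (K1 `&` K2) -> K1 w -> K2 w ->
  lifts_on H K1 -> lifts_on H K2 -> lifts_on H (K1 `|` K2).
Proof.
move=> clK1 clK2 cK K1w K2w l1 l2 z e K12z pe.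
wlog K1z : K1 K2 clK1 clK2 cK K1w K2w l1 l2 K12z / K1 z.
  move=> hw; have [K1z|K2z] := K12z; first exact: hw.
  by rewrite setUC; apply: hw => //; [rewrite setIC | left].
have [L1 [cL1 L1z pL1]] := l1 z e K1z pe.
have [L2 [cL2 L2w pL2]] := l2 w (L1 w) K2w (pL1 _ K1w).
have L12 y : K1 y -> K2 y -> L1 y = L2 y.
  move=> K1y K2y; apply: (lift_unique (k0 := w) cK) => //.
  - by apply: continuous_subspaceW cL1 => ? [].
  - by apply: continuous_subspaceW cL2 => ? [].
  - by move=> k [K1k K2k]; rewrite pL1// pL2.
pose L y := if `[< K1 y >] then L1 y else L2 y.
have LE1 y : K1 y -> L y = L1 y by rewrite /L; case: asboolP.
have LE2 y : K2 y -> L y = L2 y by rewrite /L; case: asboolP => // *; exact: L12.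
exists L; split.
- apply: withinU_continuous => //.
    by apply: (continuous_within_eq (f := L1)) => // y /LE1.
  by apply: (continuous_within_eq (f := L2)) => // y /LE2.
- by rewrite LE1.
- by move=> y [Ky|Ky]; [rewrite LE1 ?pL1|rewrite LE2 ?pL2].
Qed.

End Covering.

(** * Lifting paths and homotopies *)

Section UnitInterval.
Context (R : realType).

(** Bisection in disguise: a property of segments that holds for all short
segments around each point, and is additive, holds for the unit segment.  It
replaces Lebesgue numbers in the lifting of squares. *)
Lemma unit_interval_induction (P : R -> R -> Prop) :
  (forall x, 0 <= x <= 1 -> exists2 d, 0 < d &
     forall a b, x - d < a -> a <= b -> b < x + d -> P a b) ->
  (forall a c b, a <= c <= b -> P a c -> P c b -> P a b) ->
  P 0 1.
Proof.
move=> Ploc Padd.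
pose S : set R := [set x | 0 <= x <= 1 /\ P 0 x].
have S0 : S 0.
  split; first by rewrite lexx ler01.
  have [|d d0] := Ploc 0; first by rewrite lexx ler01.
  by apply; lra.
have ubS : ubound S 1 by move=> x [/andP[]].
have hsS : has_sup S by split; [exists 0 | exists 1].
have s0 : 0 <= sup S by apply: (sup_upper_bound hsS).
have s1 : sup S <= 1 by apply: ge_sup => //; exists 0.
have [|d d0 Pd] := Ploc (sup S); first by rewrite s0 s1.
have [x [/andP[x0 x1] Px] xs] := sup_adherent d0 hsS.
have xls : x <= sup S by apply: (sup_upper_bound hsS); split=> //; rewrite x0 x1.
have PS z : x <= z -> z < sup S + d -> P 0 z.
  move=> xz zs; apply: (Padd 0 x z) => //; first by rewrite x0 xz.
  by apply: Pd => //; lra.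
have [s1d|s1d] := ltP 1 (sup S + d); first exact: PS.
have Sz : S (sup S + d / 2).
  by split; [apply/andP; split; lra | apply: PS; lra].
have : sup S + d / 2 <= sup S by apply: (sup_upper_bound hsS).
by move=> ?; exfalso; lra.
Qed.

(** The retraction of the line onto the unit segment.  Precomposing with it turns
maps continuous within the unit segment into globally continuous ones. *)
Definition clamp (t : R) : R := Num.max 0 (Num.min 1 t).

Lemma clamp_itv t : `[0, 1]%classic (clamp t).
Proof. by rewrite /= in_itv/= /clamp le_max lexx ge_max ler01 ge_min lexx. Qed.

Lemma clamp_id t : 0 <= t <= 1 -> clamp t = t.
Proof.
by move=> /andP[t0 t1]; rewrite /clamp (min_idPr t1) (max_idPr t0).
Qed.

Lemma clamp0 : clamp 0 = 0. Proof. by rewrite clamp_id ?lexx ?ler01. Qed.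
Lemma clamp1 : clamp 1 = 1. Proof. by rewrite clamp_id ?lexx ?ler01. Qed.

Lemma clamp_continuous : continuous clamp.
Proof.
apply: max_fun_continuous; first by move=> ?; exact: cvg_cst.
apply: min_fun_continuous; first by move=> ?; exact: cvg_cst.
by move=> x; exact: cvg_id.
Qed.

Lemma concat_path (T : topologicalType) (u v : R -> T) :
  continuous u -> continuous v -> u 1 = v 0 ->
  exists w : R -> T, [/\ continuous w, w 0 = u 0, w 1 = v 1 &
    forall t, range u (w t) \/ range v (w t)].
Proof.
move=> cu cv uv.
pose w t := if t <= 2^-1 then u (2 * t) else v (2 * t - 1).
have w1 t : t <= 2^-1 -> w t = u (2 * t) by rewrite /w => ->.
have w2 t : 2^-1 <= t -> w t = v (2 * t - 1).
  rewrite /w le_eqVlt => /predU1P[<-|]; last by rewrite ltNge => /negbTE ->.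
  by rewrite lexx divff// subrr.
exists w; split.
- apply/continuous_subspace_setT.
  have -> : [set: R] = `]-oo, 2^-1] `|` `[2^-1, +oo[.
    apply/seteqP; split=> // t _ /=; rewrite !in_itv/= andbT.
    by have [?|/ltW ?] := leP t (2^-1); [left|right].
  apply: withinU_continuous; [exact: interval_closed..| |].
    apply: (@continuous_within_eq R T _ (fun t => u (2 * t))).
      by move=> t /=; rewrite in_itv/= => /w1.
    apply: continuous_subspaceT => t; apply: continuous_comp; last exact: cu.
    by apply: cvgM; [exact: cvg_cst|exact: cvg_id].
  apply: (@continuous_within_eq R T _ (fun t => v (2 * t - 1))).
    by move=> t /=; rewrite in_itv/= andbT => /w2.
  apply: continuous_subspaceT => t; apply: continuous_comp; last exact: cv.
  apply: cvgB; last exact: cvg_cst.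
  by apply: cvgM; [exact: cvg_cst|exact: cvg_id].
- by rewrite w1 ?mulr0// invr_ge0.
- by rewrite w2; [congr v; lra | lra].
- by move=> t; rewrite /w; case: ifP => _; [left|right]; eexists.
Qed.

Lemma path_extension (T : topologicalType) (x y : T) (g : R -> T) :
  is_path x y g -> exists u : R -> T,
    [/\ continuous u, u 0 = x & u 1 = y].
Proof.
move=> [cg g0 g1]; exists (g \o clamp); split => /=.
- exact: (continuous_within_comp cg clamp_continuous clamp_itv).
- by rewrite clamp0.
- by rewrite clamp1.
Qed.

Lemma segment_image_connected (T : topologicalType) (u : R -> T) (a b : R) :
  continuous u -> connected (u @` `[a, b]).
Proof.
move=> cu; apply: (@connected_continuous_connected R T).
  exact: segment_connected.
exact: continuous_subspaceT.
Qed.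

Lemma path_connected_connected (T : topologicalType) :
  path_connected R T -> connected [set: T].
Proof.
move=> pcT; have [x|nT] := pselect (exists _ : T, True); last first.
  have -> : [set: T] = set0 by apply/seteqP; split=> // t _; apply: nT; exists t.
  exact: connected0.
case: x => x _.
have -> : [set: T] =
    \bigcup_(A in [set A : set T | connected A /\ A x]) (id A).
  apply/seteqP; split=> // y _; have [g /path_extension[u [cu u0 u1]]] := pcT x y.
  exists (u @` `[0, 1]).
    split; last by exists 0 => //=; rewrite in_itv/= lexx ler01.
    exact: segment_image_connected.
  by exists 1 => //=; rewrite in_itv/= lexx ler01.
by apply: bigcup_connected; [exists x => A [] | move=> A []].
Qed.

End UnitInterval.

Section Lifting.
Context (R : realType) (E X : topologicalType) (p : E -> X).
Hypothesis cov : covering_map p.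

Lemma path_lift_unique (u v : R -> E) :
  continuous u -> continuous v -> (forall t, 0 <= t <= 1 -> p (u t) = p (v t)) ->
  u 0 = v 0 -> forall t, 0 <= t <= 1 -> u t = v t.
Proof.
move=> cu cv puv uv0 t t01.
apply: (@lift_unique _ _ _ cov R `[0, 1]%classic u v 0).
- exact: segment_connected.
- exact: continuous_subspaceT.
- exact: continuous_subspaceT.
- by move=> k; rewrite /= in_itv; exact: puv.
- by rewrite /= in_itv/= lexx ler01.
- exact: uv0.
- by rewrite /= in_itv.
Qed.

Lemma setX_closed (S T : topologicalType) (A : set S) (B : set T) :
  closed A -> closed B -> closed (A `*` B).
Proof.
move=> cA cB; have -> : A `*` B = fst @^-1` A `&` snd @^-1` B by [].
by apply: closedI; apply: preimage_closed => // -[x y] _;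
  [exact: cvg_fst|exact: cvg_snd].
Qed.

(** Two nested inductions on segments: for fixed [t], a thin strip of height [d]
around the height [t] is covered by gluing small boxes side by side; the strips
are then stacked. *)
Lemma lifts_on_square (H : R * R -> X) :
  continuous H -> lifts_on p H (`[0, 1] `*` `[0, 1]).
Proof.
move=> cH.
apply: (unit_interval_induction
  (P := fun a b => lifts_on p H (`[0, 1] `*` `[a, b]))).
  move=> t _.
  have [d d0 ld] : exists2 d, 0 < d & lifts_on p H (`[0, 1] `*` `[t - d, t + d]).
    apply: (unit_interval_induction (P := fun a b =>
      exists2 d, 0 < d & lifts_on p H (`[a, b] `*` `[t - d, t + d]))).
      move=> s _.
      have [N [[N1 N2] [/= N1s N2t] sN] lN] := lifts_on_small cov (s, t) cH.
      have /nbhs_ballP[d1 /= d10 sN1] := N1s.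
      have /nbhs_ballP[d2 /= d20 sN2] := N2t.
      exists d1 => // a b sa ab bs; exists (d2 / 2); first by rewrite divr_gt0.
      apply: lifts_onS lN => -[y z] [/=].
      rewrite !in_itv/= => /andP[ay yb] /andP[tz zt].
      apply: sN; split=> /=; [apply: sN1|apply: sN2];
        rewrite -ball_normE/= ltr_norml.
        by apply/andP; split; lra.
      by apply/andP; split; lra.
    move=> a c b /andP[ac cb] [d1 d10 l1] [d2 d20 l2].
    pose d := Num.min d1 d2.
    have d0 : 0 < d by rewrite lt_min d10 d20.
    exists d => //.
    have dd1 : d <= d1 by rewrite ge_min lexx.
    have dd2 : d <= d2 by rewrite ge_min lexx orbT.
    have {}l1 : lifts_on p H (`[a, c] `*` `[t - d, t + d]).
      apply: lifts_onS l1 => -[y z] [/= ->]; rewrite !in_itv/= => /andP[tz zt].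
      by split=> //; apply/andP; split; lra.
    have {}l2 : lifts_on p H (`[c, b] `*` `[t - d, t + d]).
      apply: lifts_onS l2 => -[y z] [/= ->]; rewrite !in_itv/= => /andP[tz zt].
      by split=> //; apply/andP; split; lra.
    apply: lifts_onS (lifts_onU (w := (c, t)) cov _ _ _ _ _ l1 l2).
    - move=> [y z] [/=]; rewrite !in_itv/= => /andP[ay yb] zt.
      by have [yc|/ltW cy] := leP y c; [left|right]; split=> //=;
        rewrite ?in_itv/= ?ay ?yb ?yc ?cy.
    - by apply: setX_closed; exact: interval_closed.
    - by apply: setX_closed; exact: interval_closed.
    - have -> : `[a, c] `*` `[t - d, t + d] `&` `[c, b] `*` `[t - d, t + d] =
          (fun z => (c, z)) @` `[t - d, t + d].
        apply/seteqP; split=> [[y z] [[/= y1 z1] [y2 _]]|_ [z z1 <-]] /=.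
          exists z => //; congr pair.
          move: y1 y2; rewrite !in_itv/= => /andP[? ?] /andP[? ?].
          by apply/eqP; rewrite eq_le; apply/andP.
        by rewrite !in_itv/= !lexx ac cb.
      apply: segment_image_connected.
      apply: (@continuous_pair R R R (fun=> c) id) => x;
        [exact: cvg_cst|exact: cvg_id].
    - by split=> /=; rewrite in_itv/= ?lexx ?ac//; apply/andP; split; lra.
    - by split=> /=; rewrite in_itv/= ?lexx ?cb//; apply/andP; split; lra.
  exists d => // a b ta ab bt; apply: lifts_onS ld => -[y z] [/= ->].
  by rewrite !in_itv/= => /andP[? ?]; split=> //; apply/andP; split; lra.
move=> a c b /andP[ac cb] l1 l2.
apply: lifts_onS (lifts_onU (w := (0, c)) cov _ _ _ _ _ l1 l2).
- move=> [y z] [/=]; rewrite !in_itv/= => yt /andP[az zb].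
  by have [zc|/ltW cz] := leP z c; [left|right]; split=> //=;
    rewrite ?in_itv/= ?az ?zb ?zc ?cz.
- by apply: setX_closed; exact: interval_closed.
- by apply: setX_closed; exact: interval_closed.
- have -> : `[0, 1] `*` `[a, c] `&` `[0, 1] `*` `[c, b] =
      (fun y => (y, c)) @` `[0, 1 : R].
    apply/seteqP; split=> [[y z] [[/= y1 z1] [_ z2]]|_ [y y1 <-]] /=.
      exists y => //; congr pair.
      move: z1 z2; rewrite !in_itv/= => /andP[? ?] /andP[? ?].
      by apply/eqP; rewrite eq_le; apply/andP.
    by rewrite !in_itv/= !lexx ac cb.
  apply: segment_image_connected.
  apply: (@continuous_pair R R R id (fun=> c)) => x; [exact: cvg_id|exact: cvg_cst].
- by split=> /=; rewrite in_itv/= ?lexx ?ac ?ler01.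
- by split=> /=; rewrite in_itv/= ?lexx ?cb ?ler01.
Qed.

Lemma clamp2_continuous : continuous (fun z : R * R => (clamp z.1, clamp z.2)).
Proof.
apply: (@continuous_pair (R * R)%type R R
  (fun z => clamp z.1) (fun z => clamp z.2)) => -[s t].
  by apply: continuous_comp; [exact: cvg_fst|exact: clamp_continuous].
by apply: continuous_comp; [exact: cvg_snd|exact: clamp_continuous].
Qed.

Lemma square_lifting (H : R * R -> X) (e : E) :
  continuous H -> p e = H (0, 0) -> exists L : R * R -> E,
    [/\ continuous L, L (0, 0) = e &
      forall s t, 0 <= s <= 1 -> 0 <= t <= 1 -> p (L (s, t)) = H (s, t)].
Proof.
move=> cH pe; have [|L [cL L0 pL]] := @lifts_on_square H cH (0, 0) e _ pe.
  by split; rewrite /= in_itv/= lexx ler01.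
exists (L \o (fun z => (clamp z.1, clamp z.2))); split.
- apply: (continuous_within_comp cL clamp2_continuous) => -[s t].
  by split; exact: clamp_itv.
- by rewrite /= clamp0.
- move=> s t s01 t01 /=; rewrite !clamp_id//; apply: pL.
  by split; rewrite /= in_itv.
Qed.

Lemma path_lifting (g : R -> X) (e : E) :
  continuous g -> p e = g 0 -> exists u : R -> E,
    [/\ continuous u, u 0 = e & forall t, 0 <= t <= 1 -> p (u t) = g t].
Proof.
move=> cg pe; have [||L [cL L0 pL]] := @square_lifting (g \o fst) e.
- by move=> [s t]; apply: continuous_comp; [exact: cvg_fst|exact: cg].
- by [].
exists (fun s => L (s, 0)); split=> //.
  move=> s; apply: (@continuous_comp R (R * R)%type E (fun s => (s, 0)) L);
    last exact: cL.
  apply: (@continuous_pair R R R id (fun=> 0)) => x; [exact: cvg_id|exact: cvg_cst].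
by move=> t t01; have := pL t 0 t01; rewrite lexx ler01 => ->.
Qed.

End Lifting.

(** * Transitivity of the covering transformations *)

(** The paths are required to stay in [U] for all real parameters, which a
clamped path does. *)
Definition locally_path_connected (R : realType) (X : topologicalType) :=
  forall (x : X) (U : set X), nbhs x U -> exists2 V, nbhs x V &
    forall y, V y -> exists g : R -> X,
      [/\ continuous g, g 0 = x, g 1 = y & forall t, U (g t)].

Section FibrePaths.
Context (R : realType) (E X : topologicalType) (p : E -> X).
Hypothesis cov : covering_map p.
Hypothesis scE : simply_connected R E.

(** A path in the fibre product of [E] with itself over [X].  If it starts at
[(e, e')] and ends at [(y, y')], the transformation taking [e] to [e'] has to
take [y] to [y']. *)
Definition fibre_path (a b : E * E) :=
  exists w : R -> E * E, [/\ continuous w, w 0 = a, w 1 = b &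
    forall t, p (w t).1 = p (w t).2].

Lemma fibre_path_sym a b : fibre_path a b -> fibre_path b a.
Proof.
move=> [w [cw w0 w1 pw]]; exists (fun t => w (1 - t)); split=> //.
- move=> t; apply: (@continuous_comp R R _ (fun t => 1 - t) w); last exact: cw.
  by apply: cvgB; [exact: cvg_cst|exact: cvg_id].
- by rewrite subr0.
- by rewrite subrr.
Qed.

Lemma fibre_path_trans a b c : fibre_path a b -> fibre_path b c -> fibre_path a c.
Proof.
move=> [w [cw w0 w1 pw]] [v [cv v0 v1 pv]].
have [|u [cu u0 u1 ru]] := concat_path cw cv; first by rewrite w1 v0.
exists u; rewrite u0 u1; split=> // t.
by have [[s _ <-]|[s _ <-]] := ru t.
Qed.

Lemma fibre_path_swap e e' y y' :
  fibre_path (e, e') (y, y') -> fibre_path (e', e) (y', y).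
Proof.
move=> [w [cw w0 w1 pw]]; exists (fun t => ((w t).2, (w t).1)).
split; [|by rewrite w0|by rewrite w1|by move=> t /=].
apply: (@continuous_pair R E E (fun t => (w t).2) (fun t => (w t).1)) => t.
  by apply: continuous_comp; [exact: cw|exact: cvg_snd].
by apply: continuous_comp; [exact: cw|exact: cvg_fst].
Qed.

Lemma fibre_path_over e e' y y' : fibre_path (e, e') (y, y') -> p y = p y'.
Proof. by move=> [w [_ _ w1 pw]]; have := pw 1; rewrite w1. Qed.

Lemma fibre_path_refl e e' : p e = p e' -> fibre_path (e, e') (e, e').
Proof. by move=> pee'; exists (fun=> (e, e')); split=> // t; exact: cvg_cst. Qed.

Lemma fibre_path_exists e e' y : p e = p e' ->
  exists y', fibre_path (e, e') (y, y').
Proof.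
move=> pee'; have [pcE _] := scE.
have [g /path_extension[u [cu u0 u1]]] := pcE e y.
have [t||v [cv v0 pv]] := @path_lifting R _ _ _ cov (p \o u) e'.
- by apply: continuous_comp; [exact: cu | have [cp _ _] := cov; exact: cp].
- by rewrite /= u0.
exists (v 1), (fun t => (u (clamp t), v (clamp t))); split.
- apply: (@continuous_pair R E E (u \o @clamp R) (v \o @clamp R)) => t.
    by apply: continuous_comp; [exact: clamp_continuous|exact: cu].
  by apply: continuous_comp; [exact: clamp_continuous|exact: cv].
- by rewrite clamp0 u0 v0.
- by rewrite clamp1 u1.
- by move=> t /=; rewrite pv//; have := clamp_itv t; rewrite /= in_itv.
Qed.

(** The monodromy argument: the first component [u] of the path is a loop at [y],
hence null homotopic.  Lifting the projected homotopy from [z] gives a square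
whose bottom side is the second component, by uniqueness of lifts, and whose
three other sides are constant, because they lift constant paths.  Both ends of
the bottom side are therefore equal. *)
Lemma fibre_path_loop y z z' : fibre_path (y, z) (y, z') -> z = z'.
Proof.
move=> [w [cw w0 w1 pw]]; have [cp _ _] := cov; have [_ scE'] := scE.
have cu : continuous (fun t => (w t).1).
  by move=> t; apply: continuous_comp; [exact: cw|exact: cvg_fst].
have cv : continuous (fun t => (w t).2).
  by move=> t; apply: continuous_comp; [exact: cw|exact: cvg_snd].
have [|H [cH Hs Ht]] := scE' y (fun t => (w t).1).
  by split; [exact: continuous_subspaceT | rewrite w0 | rewrite w1].
pose H' := H \o (fun z : R * R => (clamp z.1, clamp z.2)).
have cH' : continuous H'.
  apply: (continuous_within_comp cH (@clamp2_continuous R)) => -[s t].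
  by split; exact: clamp_itv.
have H'E s t : 0 <= s <= 1 -> 0 <= t <= 1 -> H' (s, t) = H (s, t).
  by move=> s01 t01; rewrite /H' /= !clamp_id.
have i0 : 0 <= (0 : R) <= 1 by rewrite lexx ler01.
have i1 : 0 <= (1 : R) <= 1 by rewrite lexx ler01.
have pz : p z = p y by have := pw 0; rewrite w0.
have pz' : p z' = p y by have := pw 1; rewrite w1.
have [q||L [cL L0 pL]] := @square_lifting R _ _ _ cov (p \o H') z.
- by apply: continuous_comp; [exact: cH'|exact: cp].
- by rewrite /= H'E// (Ht 0 i0).1.
have cLs t : continuous (fun s => L (s, t)).
  move=> s; apply: (@continuous_comp R (R * R)%type E (fun s => (s, t)) L);
    last exact: cL.
  by apply: (@continuous_pair R R R id (fun=> t)) => x;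
    [exact: cvg_id|exact: cvg_cst].
have cLt s : continuous (fun t => L (s, t)).
  move=> t; apply: (@continuous_comp R (R * R)%type E (fun t => (s, t)) L);
    last exact: cL.
  by apply: (@continuous_pair R R R (fun=> s) id) => x;
    [exact: cvg_cst|exact: cvg_id].
have {}pL s t : 0 <= s <= 1 -> 0 <= t <= 1 -> p (L (s, t)) = p (H (s, t)).
  by move=> s01 t01; rewrite pL//= H'E.
have ccst (c : E) : continuous (fun _ : R => c) by move=> ?; exact: cvg_cst.
(* The four sides of the lifted square, from the bottom one. *)
have L10 : L (1, 0) = z'.
  rewrite (path_lift_unique cov (cLs 0) cv _ _ i1) ?w1//.
    by move=> s s01; rewrite pL// (Hs s s01).1 pw.
  by rewrite L0 w0.
have L01 : L (0, 1) = z.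
  rewrite (path_lift_unique cov (cLt 0) (ccst z) _ _ i1)//.
  by move=> t t01; rewrite pL// (Ht t t01).1.
have L11 : L (1, 1) = z.
  rewrite (path_lift_unique cov (cLs 1) (ccst z) _ _ i1)//.
  by move=> s s01; rewrite pL// (Hs s s01).2.
rewrite -L11 (path_lift_unique cov (cLt 1) (ccst z') _ _ i1)//.
by move=> t t01; rewrite pL// (Ht t t01).2.
Qed.

Lemma fibre_path_unique a y z z' :
  fibre_path a (y, z) -> fibre_path a (y, z') -> z = z'.
Proof.
move=> /fibre_path_sym az az'; apply: (@fibre_path_loop y).
exact: fibre_path_trans az az'.
Qed.

Hypothesis lpcX : locally_path_connected R X.

(** Continuity of the correspondence [y |-> y'] at [e]: choose sheets around [e]
and [e'] over the same open set, with sections [s] and [s'].  A point [y] near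
[e] is joined to [e] by the image under [s] of a short path of [X], and the
image of this path under [s'] stays in the prescribed neighbourhood of [e']. *)
Lemma fibre_path_near e e' : p e = p e' ->
  forall W, nbhs e' W -> \forall y \near e, exists2 y', W y' &
    fibre_path (e, e') (y, y').
Proof.
move=> pee' W We'.
have [U [oU Upe secU]] := covering_local_section cov (p e).
have [V [s [[oV Vs Us cs] Ve]]] := secU e Upe.
have [|V' [s' [[oV' Vs' Us' cs'] Ve']]] := secU e'; first by rewrite -pee'.
have sWU : nbhs (p e) (s' @^-1` W `&` U).
  apply: filterI; last exact: open_nbhs_nbhs.
  by apply: (cs' _ Upe); rewrite pee' (Vs' _ Ve').2.
have [N Npe gN] := lpcX sWU; have [cp _ _] := cov.
have nV : nbhs e V by exact: open_nbhs_nbhs.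
have nN : nbhs e (p @^-1` N) by exact: cp.
near=> y.
have Vy : V y by near: y.
have /gN[g [cg g0 g1 gU]] : N (p y) by near: y.
exists (s' (p y)); first by rewrite -g1; have [] := gU 1.
exists (fun t => (s (g t), s' (g t))); split.
- apply: (@continuous_pair R E E (s \o g) (s' \o g)) => t.
    by apply: continuous_comp; [exact: cg|apply: cs; have [] := gU t].
  by apply: continuous_comp; [exact: cg|apply: cs'; have [] := gU t].
- by rewrite g0 (Vs _ Ve).2 pee' (Vs' _ Ve').2.
- by rewrite g1 (Vs _ Vy).2.
- by move=> t; have [_ Ugt] := gU t; rewrite (Us _ Ugt).2 (Us' _ Ugt).2.
Unshelve. all: by end_near. Qed.

Lemma fibre_path_map e e' : p e = p e' ->
  exists a : E -> E, continuous a /\ forall y, fibre_path (e, e') (y, a y).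
Proof.
move=> pee'; have [a ea] := choice (fun y => fibre_path_exists y pee').
exists a; split=> // y W aW.
have := fibre_path_near (fibre_path_over (ea y)) aW.
rewrite nbhs_simpl/=; apply: filterS => z [z' Wz' yz].
by rewrite /= (fibre_path_unique (ea z) (fibre_path_trans (ea y) yz)).
Qed.

(** The maps obtained from [(e, e')] and from [(e', e)] are inverse to each
other. *)
Lemma deck_transitive e e' : p e = p e' -> exists a : deck p, a e = e'.
Proof.
move=> pee'; have [a [ca ea]] := fibre_path_map pee'.
have [b [cb eb]] := fibre_path_map (esym pee').
have aK : cancel a b.
  by move=> y; apply: (fibre_path_unique (eb (a y))); apply/fibre_path_swap/ea.
have bK : cancel b a.
  by move=> y; apply: (fibre_path_unique (ea (b y))); apply/fibre_path_swap/eb.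
have pa : p \o a = p by apply/funext => y /=; rewrite -(fibre_path_over (ea y)).
exists (Deck ca cb aK bK pa) => /=.
exact: (fibre_path_unique (ea e) (fibre_path_refl pee')).
Qed.

Lemma deck_free (a b : deck p) (x : E) : a x = b x -> a = b.
Proof.
move=> abx; apply/deck_ext/funext => y.
have [pcE _] := scE.
apply: (@lift_unique _ _ _ cov E setT a b x) => //.
- exact: path_connected_connected pcE.
- by apply/continuous_subspaceT; exact: deck_continuous.
- by apply/continuous_subspaceT; exact: deck_continuous.
- by move=> k _; rewrite -[LHS]/((p \o a) k) -[RHS]/((p \o b) k) !deck_over.
Qed.

End FibrePaths.

(** * Local topology of finite polyhedra *)

Lemma continuous_set_val (T : topologicalType) (A : set T) :
  continuous (set_val : A -> T).
Proof. exact: initial_continuous. Qed.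

Lemma continuous_set_type (S T : topologicalType) (A : set T) (f : S -> A) :
  continuous (set_val \o f) -> continuous f.
Proof.
move=> /continuousP cf; apply/continuousP => _ [B oB <-].
by rewrite -comp_preimage; exact: cf.
Qed.

Lemma hausdorff_injective (S T : topologicalType) (f : S -> T) :
  continuous f -> injective f -> hausdorff_space T -> hausdorff_space S.
Proof.
move=> /continuousP cf injf; rewrite !open_hausdorff => hT x y xy.
have [|[A B] /= [fxA fyB] [oA oB AB]] := hT (f x) (f y).
  by apply: contra_neq xy; exact: injf.
exists (f @^-1` A, f @^-1` B) => /=.
  by move: fxA fyB; rewrite !inE.
split; [exact: cf|exact: cf|].
by rewrite -preimage_setI (eqP AB) preimage_set0.
Qed.

Section Polyhedra.
Context (R : realType) (m : nat).
Implicit Types (s : {fset 'rV[R]_m}) (K : {fset {fset 'rV[R]_m}}).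

Lemma continuous_sum (T : topologicalType) (V : normedModType R) (I : Type)
    (r : seq I) (F : I -> T -> V) :
  (forall i, continuous (F i)) -> continuous (fun x => \sum_(i <- r) F i x).
Proof.
move=> cF; elim: r => [|i r IHr].
  have -> : (fun x => \sum_(i <- [::]) F i x) = (fun=> 0).
    by apply/funext => x; rewrite big_nil.
  by move=> x; exact: cvg_cst.
have -> : (fun x => \sum_(j <- i :: r) F j x) =
    (fun x => F i x + \sum_(j <- r) F j x).
  by apply/funext => x; rewrite big_cons.
by move=> x; apply: cvgD; [exact: cF|exact: IHr].
Qed.

Lemma continuous_scale (T : topologicalType) (V : normedModType R)
    (k : T -> R) (v : V) :
  continuous k -> continuous (fun x => k x *: v).
Proof. by move=> ck x; apply: cvgZr_tmp; exact: ck. Qed.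

(** The hull is the continuous image of the standard simplex of weights. *)
Lemma convex_hull_compact s : compact (convex_hull s).
Proof.
pose k := #|` s|; pose v (i : 'I_k) := nth 0 s i.
have eqv (V : nmodType) (F : 'rV[R]_m -> V) : \sum_(x <- s) F x = \sum_i F (v i).
  by rewrite (big_nth 0) big_mkord.
pose D := [set u : 'rV[R]_k | (forall i, `[0, 1]%classic (u ord0 i))] `&`
  [set u : 'rV[R]_k | \sum_i u ord0 i = 1].
have cD : compact D.
  apply: compact_closedI.
    apply: (@rV_compact R k (fun=> `[0, 1]%classic)) => i.
    exact: segment_compact.
  have -> : [set u : 'rV[R]_k | \sum_i u ord0 i = 1] =
    (fun u : 'rV[R]_k => \sum_i u ord0 i) @^-1` [set 1] by [].
  apply: preimage_closed; last exact: closed_eq.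
  move=> u _; apply: (@continuous_sum 'rV[R]_k R^o) => i.
  exact: coord_continuous.
have -> : convex_hull s = (fun u => \sum_i u ord0 i *: v i) @` D.
  apply/seteqP; split=> [x [w [w0 w1 ->]]|_ [u [u01 u1] <-]].
    exists (\row_i w (v i)); last first.
      by rewrite eqv; apply: eq_bigr => i _; rewrite mxE.
    have sw : \sum_i w (v i) = 1 by rewrite -w1 eqv.
    have vs i : v i \in s by apply: mem_nth.
    split=> [i|] /=.
      rewrite mxE in_itv/= w0//= -sw (bigD1 i)//= lerDl.
      by apply: sumr_ge0 => j _; exact: w0.
    by under eq_bigr do rewrite mxE.
  (* A vertex is recovered from its index in [s]; off [s] the weight is [0]. *)
  pose w x := if insub (index x s) is Some i then u ord0 i else 0.
  have wv i : w (v i) = u ord0 i.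
    rewrite /w /v index_uniq ?fset_uniq//.
    by rewrite valK.
  exists w; split.
  - move=> x xs; rewrite /w; case: insubP => // i _ _.
    by have := u01 i; rewrite /= in_itv/= => /andP[].
  - by rewrite eqv -u1; apply: eq_bigr => i _; exact: wv.
  - by rewrite eqv; apply: eq_bigr => i _; rewrite wv.
apply: continuous_compact cD; apply: continuous_subspaceT.
apply: continuous_sum => i; apply: (@continuous_scale 'rV[R]_k 'rV[R]_m).
exact: coord_continuous.
Qed.

Lemma convex_hull_segment s x y (t : R) : 0 <= t <= 1 ->
  convex_hull s x -> convex_hull s y -> convex_hull s (x + t *: (y - x)).
Proof.
move=> /andP[t0 t1] [w [w0 w1 ->]] [w' [w'0 w'1 ->]].
exists (fun v => (1 - t) * w v + t * w' v); split.
- by move=> v vs; rewrite addr_ge0// mulr_ge0 ?w0 ?w'0 ?subr_ge0.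
- by rewrite big_split/= -!mulr_sumr w1 w'1 !mulr1 subrK.
- under [RHS]eq_bigr do rewrite scalerDl -!scalerA.
  by rewrite big_split/= -!scaler_sumr scalerBl scale1r scalerBr addrAC addrA.
Qed.

(** The simplices that avoid [a] are closed and finitely many, so a small
neighbourhood of [a] meets only simplices containing [a], and these contain the
segments from [a] to their points. *)
Lemma underlying_space_star K a (e : R) : 0 < e -> underlying_space K a ->
  exists2 N, nbhs a N & forall y, N y -> underlying_space K y ->
    forall t, 0 <= t <= 1 ->
      underlying_space K (a + t *: (y - a)) /\ `|t *: (y - a)| < e.
Proof.
move=> e0 Ka.
pose F s := if `[< convex_hull s a >] then setT else ~` convex_hull s.
have aF : nbhs a (\bigcap_(s in [set` K]) F s).
  apply: (@filter_bigI _ _ K F (nbhs a)) => s _; rewrite /F.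
  case: asboolP => [_|nsa]; first exact: filterT.
  apply: open_nbhs_nbhs; split=> //; apply: closed_openC.
  apply: compact_closed; last exact: convex_hull_compact.
  exact: (@norm_hausdorff R 'rV[R]_m).
exists (\bigcap_(s in [set` K]) F s `&` ball a e).
  by apply: filterI => //; exact: nbhsx_ballx.
move=> y [Fy ay] [s Ks sy] t t01; split.
  have := Fy s Ks; rewrite /F; case: asboolP => // sa _.
  by exists s => //; exact: convex_hull_segment.
move: ay t01; rewrite -ball_normE/= distrC => ay /andP[t0 t1].
rewrite normrZ ger0_norm//; apply: le_lt_trans ay.
by rewrite ler_piMl.
Qed.

End Polyhedra.

Lemma finite_polyhedron_hausdorff (R : realType) (X : topologicalType) :
  finite_polyhedron R X -> hausdorff_space X.
Proof.
move=> [m [K [_ [g [h [cg ch gK hK]]]]]].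
apply: (@hausdorff_injective _ 'rV[R]_m (set_val \o g)); last exact: norm_hausdorff.
  by move=> x; apply: continuous_comp; [exact: cg|exact: continuous_set_val].
by move=> x y /= /val_inj; exact: can_inj.
Qed.

Lemma finite_polyhedron_locally_path_connected (R : realType)
    (X : topologicalType) :
  finite_polyhedron R X -> locally_path_connected R X.
Proof.
move=> [m [K [_ [g [h [cg ch gK hK]]]]]] x U xU.
pose A := underlying_space K.
pose a : 'rV[R]_m := set_val (g x).
have Aa : A a by exact: set_valP.
have : nbhs (g x) (h @^-1` U) by apply: ch; rewrite gK.
move=> [_ [[B oB <-] Ba BU]].
have /nbhs_ballP[e /= e0 eB] : nbhs a B by exact: open_nbhs_nbhs.
have [N aN starN] := underlying_space_star e0 Aa.
exists ((set_val \o g : X -> 'rV[R]_m) @^-1` N).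
  have cvg : continuous (set_val \o g : X -> 'rV[R]_m).
    by move=> z; apply: continuous_comp; [exact: cg|exact: continuous_set_val].
  exact: cvg.
move=> y /= Ny.
pose y' : 'rV[R]_m := set_val (g y).
have Ay' : A y' by exact: set_valP.
have ct (t : R) : 0 <= clamp t <= 1 by have := clamp_itv t; rewrite /= in_itv.
have seg (t : R) := starN _ Ny Ay' (clamp t) (ct t).
pose w (t : R) : set_type A := SigSub (mem_set (seg t).1).
have cw : continuous w.
  apply: continuous_set_type => t.
  apply: cvgD; first exact: cvg_cst.
  by apply: cvgZr_tmp; exact: clamp_continuous.
exists (h \o w); split.
- by move=> t; apply: continuous_comp; [exact: cw|exact: ch].
- rewrite /= -[RHS]gK; congr h; apply: val_inj => /=.
  by rewrite clamp0 scale0r addr0.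
- rewrite /= -[RHS]gK; congr h; apply: val_inj => /=.
  by rewrite clamp1 scale1r addrC subrK.
- move=> t; apply: BU; apply: eB; rewrite -ball_normE/=.
  by rewrite opprD addrA subrr sub0r normrN; have [] := seg t.
Qed.

Lemma continuous_ptws (S T : topologicalType) (I : eqType)
    (g : S -> {ptws I -> T}) :
  (forall i, continuous (fun x => g x i)) -> continuous g.
Proof.
move=> cg x; apply/cvg_sup => i W [_ [[B oB <-] /= Bg] sBW].
have := cg i x B; rewrite !nbhs_simpl/= => /(_ (open_nbhs_nbhs (conj oB Bg))).
by apply: filterS => y; exact: sBW.
Qed.

(** * Lift-factors as translates of the basic coordinates *)

Section LiftFactors.
Context (R : realType) (E X : topologicalType) (p : E -> X) (n : nat).
Hypothesis cov : covering_map p.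
Hypothesis scE : simply_connected R E.
Hypothesis lpcX : locally_path_connected R X.
Hypothesis hausX : hausdorff_space X.
Context (f : X -> Dconf X n) (xs : E) (fb : E -> orbit_conf p n).
Hypothesis fb_lifting : lifting f fb.

Let h := Defs.coord fb.

Lemma lift_coord_continuous (gb : E -> orbit_conf p n) i :
  continuous gb -> continuous (Defs.coord gb i).
Proof.
move=> cgb x; apply: (@continuous_comp _ _ _ gb (fun y => set_val y i)).
  exact: cgb.
apply: (@continuous_comp _ {ptws 'I_n -> E} _ set_val (fun y => y i)).
  exact: continuous_set_val.
exact: (@proj_continuous 'I_n (fun=> E) i).
Qed.

Lemma coord_orbit x i j (a : deck p) : h i x = a (h j x) -> i = j.
Proof.
move=> hij; apply/eqP/negPn/negP => ij.
exact: (@set_valP _ _ (fb x) i j a ij).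
Qed.

Lemma deck_coord_inj x i j (a b : deck p) :
  a (h i x) = b (h j x) -> i = j /\ a = b.
Proof.
move=> ab; have ij : i = j.
  apply: (@coord_orbit x i j (a^-1 * b)%g) => /=.
  by rewrite -ab deck_funK.
by subst j; split=> //; exact: (deck_free cov scE ab).
Qed.

(** Two coordinates in the same fibre would be related by a covering
transformation, which the orbit configuration space forbids. *)
Lemma proj_coord_inj x i j : p (h i x) = p (h j x) -> i = j.
Proof.
by move=> /esym/(deck_transitive cov scE lpcX)[a /esym]; exact: coord_orbit.
Qed.

Section Decomposition.
Context (g : E -> E).
Hypothesis cg : continuous g.
Hypothesis pg : forall x, exists j, p (g x) = p (h j x).

(** Near [x] the point [p (g y)] stays away from all [p (h i y)] with [i != j], so
it equals [p (h j y)]; the maps [g] and [a \o h j] then have the same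
projection and their values lie in one sheet around [g x]. *)
Lemma agree_near (a : deck p) j x : g x = a (h j x) ->
  \forall y \near x, g y = a (h j y).
Proof.
move=> gx; have [cp _ _] := cov; have [cfb _] := fb_lifting.
have ch i : continuous (h i) by exact: lift_coord_continuous.
have pa (b : deck p) z : p (b z) = p z by rewrite -[LHS]/((p \o b) z) deck_over.
have cah : continuous (a \o h j).
  by move=> z; apply: continuous_comp; [exact: ch|exact: deck_continuous].
have cpg : continuous (p \o g).
  by move=> z; apply: continuous_comp; [exact: cg|exact: cp].
have cph i : continuous (p \o h i).
  by move=> z; apply: continuous_comp; [exact: ch|exact: cp].
have nph : \forall y \near x, forall i, i != j -> p (g y) <> p (h i y).
  apply: (@filter_forall _ _
    (fun i y => i != j -> p (g y) <> p (h i y)) (nbhs x)) => i.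
  have [->|ij] := eqVneq i j; first by apply: nearW.
  move: hausX; rewrite open_hausdorff => /(_ (p (g x)) (p (h i x)))[|[A B]] /=.
    by rewrite gx pa; apply: contra_neq ij => /proj_coord_inj.
  rewrite !inE => -[Ag Bh] [oA oB AB].
  have nA := cpg x A (open_nbhs_nbhs (conj oA Ag)).
  have nB := cph i x B (open_nbhs_nbhs (conj oB Bh)).
  near=> y => _ gh.
  have : (A `&` B) (p (g y)) by split; [|rewrite gh]; near: y.
  by rewrite AB.
have [U [oU Ux secU]] := covering_local_section cov (p (g x)).
have [V [s [[oV Vs _ _] Vg]]] := secU _ Ux.
have nV := cg (open_nbhs_nbhs (conj oV Vg)).
rewrite gx in Vg; have nV' := cah x V (open_nbhs_nbhs (conj oV Vg)).
near=> y.
have Vgy : V (g y) by near: y.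
have Vay : V (a (h j y)) by near: y.
have nphy : forall i, i != j -> p (g y) <> p (h i y) by near: y.
have [i pgi] := pg y.
have [ij|/nphy//] := eqVneq i j; subst i.
by rewrite -[LHS](Vs _ Vgy).2 -[RHS](Vs _ Vay).2 pa pgi.
Unshelve. all: by end_near. Qed.

(** Every point [x] belongs to the set where [g = a \o h j] for some pair [(a, j)]
that [x] determines.  These sets are open by [agree_near] and pairwise disjoint,
so, [E] being connected, one of them is everything. *)
Lemma coord_decomposition : exists (a : deck p) j, g = a \o h j.
Proof.
have agree_at x : exists (a : deck p) j, g x = a (h j x).
  have [j /esym/(deck_transitive cov scE lpcX)[a]] := pg x.
  by exists a, j.
have [a [j gxs]] := agree_at xs; exists a, j; apply/funext => x.
have [pcE _] := scE.
apply: (connected_locally_constant (path_connected_connected pcE)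
  (P := [set x | g x = a (h j x)]) _ _ _ gxs) => //= k _ gk.
  by apply: filterS (agree_near gk).
have [b [i gk']] := agree_at k.
apply: filterS (agree_near gk') => y gy _; rewrite gy => /deck_coord_inj[ij ba].
by apply: gk; rewrite gk' ij ba.
Qed.

End Decomposition.

Lemma lift_factor_coord (g : E -> E) :
  lift_factor p f g -> exists (a : deck p) j, g = a \o h j.
Proof.
move=> [gb [i [[cgb pgb] ->]]]; apply: coord_decomposition.
  exact: lift_coord_continuous.
move=> x; have [_ pfb] := fb_lifting.
have : proj_conf (fb x) (p (Defs.coord gb i x)) by rewrite pfb -pgb; exists i.
by move=> [j _ pj]; exists j.
Qed.

Lemma deck_coord_lift_factor (a : deck p) i : lift_factor p f (a \o h i).
Proof.
have [cfb pfb] := fb_lifting.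
pose gb := Defs.act (Semidirect (fun=> a) 1%g) \o fb.
have gbE x j : set_val (gb x) j = a (h j x).
  have s1 : ((1 : 'S_n)^-1)%g j = j by rewrite invg1 perm1.
  exact: (congr1 (fun i => a (h i x)) s1).
exists gb, i; split; last by apply/funext => x; rewrite /Defs.coord gbE.
split.
  apply: continuous_set_type; apply: continuous_ptws => j.
  rewrite (_ : (fun x => _) = a \o h j); last by apply/funext => x; exact: gbE.
  move=> x; apply: continuous_comp; last exact: deck_continuous.
  exact: lift_coord_continuous.
move=> x; rewrite -pfb /proj_conf.
rewrite (_ : (fun i => p (set_val (gb x) i)) = (fun i => p (set_val (fb x) i)))//.
by apply/funext => j; rewrite gbE -[LHS]/((p \o a) _) deck_over.
Qed.

Context (psi : deck p -> semidirect p n).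
Hypothesis fb_psi : associated_hom fb psi.

Lemma coord_deck (c : deck p) j x :
  h j (c x) = phi psi j c (h ((sigma psi c)^-1 j)%g x).
Proof. by rewrite /h /Defs.coord -fb_psi. Qed.

Lemma sigma1 j : sigma psi 1%g j = j.
Proof.
have /coord_orbit {1}-> := coord_deck 1%g j xs.
by rewrite permKV.
Qed.

(** Both sides are read off the identity [h j (c (c^-1 x)) = h j x]: the indices
that occur on its two sides are equal. *)
Lemma sigmaV c j : (sigma psi (c^-1)%g)^-1%g j = sigma psi c j.
Proof.
pose i := sigma psi c j.
have : h i (c (c^-1 xs)%g) = h i xs by rewrite /= deck_invK.
rewrite 2!coord_deck permK => /esym.
rewrite -[X in _ = X]/((phi psi i c * phi psi j c^-1)%g _).
by move=> /coord_orbit.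
Qed.

(** Conjugating [b \o h j] by [c] gives
[(c * b * phi_j (c^-1)) \o h (sigma_c j)], and a translate determines its index
and its transformation. *)
Lemma lift_factor_equivP (a b : deck p) i j :
  lift_factor_equiv p (a \o h i) (b \o h j) <->
  exists2 c, sigma psi c j = i & a = (c * b * phi psi j c^-1)%g.
Proof.
have conj (c : deck p) : c \o (b \o h j) \o (c^-1)%g =
    (c * b * phi psi j c^-1)%g \o h (sigma psi c j).
  apply/funext => x; rewrite -sigmaV.
  exact: (congr1 (fun y => c (b y)) (coord_deck (c^-1)%g j x)).
split=> [[c]|[c <- ->]]; last by exists c; rewrite conj.
rewrite conj => /(congr1 (fun g => g xs)) eq_xs.
by have [-> ->] := deck_coord_inj eq_xs; exists c.
Qed.

End LiftFactors.

(** * Counting *)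

Section Counting.
Context (R : realType).
Local Open Scope ereal_scope.

Lemma counting_card_eq (T U : choiceType) (A : set T) (B : set U) :
  (A #= B)%card -> counting A = counting B :> \bar R.
Proof.
move=> AB; rewrite /counting -(eq_finite_set AB).
by case: asboolP => // fA; rewrite (fcard_eq _ _ AB)// -(eq_finite_set AB).
Qed.

Lemma counting_setU (T : choiceType) (A B : set T) : A `&` B = set0 ->
  counting (A `|` B) = counting A + counting B :> \bar R.
Proof.
move=> AB0; rewrite /counting finite_setU.
case: (asboolP (finite_set A)) => fA; last first.
  rewrite asboolF; last by case.
  by case: ifP.
case: (asboolP (finite_set B)) => fB; last by rewrite asboolF; [|case].
rewrite asboolT// fset_setU// -EFinD -natrD -cardfsUI -fset_setI//.
by rewrite AB0 fset_set0 cardfs0 addn0.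
Qed.

Lemma counting_bigsetU (T : choiceType) (I : finType) (P : pred I)
    (F : I -> set T) :
  (forall i j, P i -> P j -> i != j -> F i `&` F j = set0) ->
  counting (\big[setU/set0]_(i | P i) F i) =
    \sum_(i | P i) counting (F i) :> \bar R.
Proof.
move=> disj; rewrite -!(big_filter (index_enum I) P).
have := filter_uniq P (index_enum_uniq I).
have : all P [seq i <- index_enum I | P i] by exact: filter_all.
elim: [seq i <- index_enum I | P i] => [|i r IHr] /=.
  by rewrite !big_nil /counting asboolT// fset_set0.
move=> /andP[Pi Pr] /andP[ir ur]; rewrite !big_cons counting_setU ?IHr//.
rewrite -bigcup_seq; apply/seteqP; split=> // x [Fix [j /= jr Fjx]].
have ij : i != j by apply: contraNneq ir => ->.
have [sub0 _] := iffLR (seteqP _ _) (disj i j Pi (allP Pr _ jr) ij).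
by apply: (sub0 x).
Qed.
End Counting.

Section Classes.
Context (R : realType) (T S : Type) (A : set T) (e : T -> T -> Prop).
Local Open Scope ereal_scope.
Hypothesis er : forall x, A x -> e x x.
Hypothesis es : forall x y, A x -> A y -> e x y -> e y x.
Hypothesis et : forall x y z, A x -> A y -> A z -> e x y -> e y z -> e x z.

Let cls x := [set y | A y /\ e x y].

Lemma class_eqP x y : A x -> A y -> cls x = cls y <-> e x y.
Proof.
move=> Ax Ay; split=> [xy|exy].
  have [] : cls x y by rewrite xy; split=> //; exact: er.
  by [].
apply/seteqP; split=> z [Az ez]; split=> //.
  by apply: (et Ay Ax Az) => //; exact: es.
exact: (et Ax Ay Az).
Qed.

(** Taking preimages under [m] is a bijection from the classes that meet the range
of [m] onto the classes of the relation induced by [m]. *)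
Lemma number_of_classes_preimage (m : S -> T) (e' : S -> S -> Prop) :
  (forall a, A (m a)) -> (forall a b, e' a b <-> e (m a) (m b)) ->
  number_of_classes R setT e' = counting [set cls (m a) | a in setT].
Proof.
move=> Am e'E; rewrite /number_of_classes.
have -> : [set [set b | setT b /\ e' a b] | a in setT] =
    (fun C : set T => m @^-1` C) @` [set cls (m a) | a in setT].
  rewrite image_comp; congr (_ @` _); apply/funext => a /=.
  by apply/seteqP; split=> b [_ /e'E eab]; split.
apply: counting_card_eq; apply: inj_card_eq.
move=> _ _ /set_mem[a _ <-] /set_mem[b _ <-] ab.
apply/class_eqP => //.
have [] : (m @^-1` cls (m a)) b by rewrite ab; split=> //; exact: er.
by [].
Qed.

(** If every class meets the range of [m i] for exactly one [i] in [r], its classes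
are distributed over the relations induced by the maps [m i]. *)
Lemma number_of_classes_sum (I : finType) (r : {set I}) (m : I -> S -> T)
    (e' : I -> S -> S -> Prop) :
  (forall i a, A (m i a)) ->
  (forall i a b, e' i a b <-> e (m i a) (m i b)) ->
  (forall x, A x -> exists i a, i \in r /\ e (m i a) x) ->
  (forall i j a b, i \in r -> j \in r -> e (m i a) (m j b) -> i = j) ->
  number_of_classes R A e = \sum_(i in r) number_of_classes R setT (e' i).
Proof.
move=> Am e'E cover disj; rewrite /number_of_classes.
under eq_bigr do rewrite -/(number_of_classes R setT _)
  (number_of_classes_preimage (Am _) (e'E _)).
rewrite -counting_bigsetU; last first.
  move=> i j ir jr ij; apply/seteqP; split=> // _ [[a _ <-] [b _]].
  move=> /class_eqP-/(_ (Am _ _) (Am _ _)) /(disj _ _ _ _ jr ir) ji.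
  by rewrite ji eqxx in ij.
congr counting; rewrite -bigcup_pred; apply/seteqP; split.
  move=> _ [x Ax <-]; have [i [a [ir ax]]] := cover x Ax.
  by exists i => //; exists a => //; apply/class_eqP.
by move=> _ [i _ [a _ <-]]; exists (m i a).
Qed.
End Classes.

(** * The formula *)

Local Open Scope ereal_scope.

Theorem mainTheorem3 (R : realType) (X E : topologicalType) (p : E -> X)
    (n : nat) (f : X -> Dconf X n) (xs : E) (x0 : orbit_conf p n)
    (fb : E -> orbit_conf p n) (psi : deck p -> semidirect p n)
    (reps : {set 'I_n}) :
  finite_polyhedron R X ->
  connected [set: X] ->
  universal_covering R p ->
  (1 <= n)%N ->
  continuous f ->
  basic_lifting f xs x0 fb ->
  associated_hom fb psi ->
  (forall j : 'I_n, exists! i : 'I_n, i \in reps /\ sigma_equiv psi i j) ->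
  reidemeister R p f = \sum_(i in reps) reidemeister_phi R psi i.
Proof.
move=> polyX _ [cov scE] _ _ [_ fb_lifting _] fb_psi repsP.
have lpcX := finite_polyhedron_locally_path_connected polyX.
have hausX := finite_polyhedron_hausdorff polyX.
have equivP := lift_factor_equivP cov scE xs fb_psi.
have fb_sigma1 := sigma1 xs fb_psi.
rewrite /reidemeister /reidemeister_phi.
apply: (@number_of_classes_sum R (E -> E) (deck p) (lift_factor p f)
  (lift_factor_equiv p) _ _ _ 'I_n reps (fun i a => a \o Defs.coord fb i)
  (phi_equiv psi)).
- by move=> g _; exists 1%g; apply/funext => x /=.
- move=> g h _ _ [a ->]; exists (a^-1)%g.
  by apply/funext => x /=; rewrite !deck_funK.
- by move=> g h k _ _ _ [a ->] [b ->]; exists (a * b)%g; apply/funext => x /=.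
- by move=> i a; exact: deck_coord_lift_factor.
- move=> i a b; rewrite equivP.
  by split=> -[c]; exists c.
- move=> g /(lift_factor_coord cov scE lpcX hausX xs fb_lifting)[b [j ->]].
  have [i [[ir [c cji]] _]] := repsP j.
  by exists i, (c * b * phi psi j c^-1)%g; split=> //; apply/equivP; exists c.
- move=> i j a b ir jr /equivP[c cji _].
  have [k [_ uniqk]] := repsP j.
  rewrite -(uniqk i); last by split=> //; exists c.
  by apply: uniqk; split=> //; exists 1%g; exact: fb_sigma1.
Qed.
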